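(* Let $q$ be a prime power, let $n_0,n_1,\dots$ be a factor sequence, let $M(\mathbb{F}_q)$ be the completion of the direct limit of the sequence $M_{n_0}(\mathbb{F}_q)\hookrightarrow M_{n_1}(\mathbb{F}_q)\hookrightarrow\cdots$, let $n\ge 1$, and let $\phi:M_n(\mathbb{F}_q)\hookrightarrow M(\mathbb{F}_q)$ be an embedding. Then for each $\varepsilon>0$ there exists $N$ such that for every $K\ge N$, writing $n_K=mn+r$ with integers $m\geq 0$ and $0\le r<n$, there is an $\frac{r}{n_K}$-embedding $\psi:M_n(\mathbb{F}_q)\to M_{n_K}(\mathbb{F}_q)$ such that $d(\iota_{n_K}\circ\psi,\phi)<\varepsilon$. In particular, if $n$ divides $n_K$, then $\psi$ is an embedding.
   Context: Each $M_n(\mathbb{F}_q)$ carries the metric $d(x,y)=\frac{\mathrm{rank}(x-y)}{n}$. For $m\mid n$, $\iota_{n,m}:M_m(\mathbb{F}_q)\to M_n(\mathbb{F}_q)$ is the isometric unital embedding $x\mapsto x\otimes 1_{n/m}$. A factor sequence is a sequence $n_0,n_1,\dots$ of positive integers with $n_k\mid n_{k+1}$ for all $k$ and $n_k\to\infty$. The direct limit is taken along the maps $\iota_{n_{k+1},n_k}$ and carries the induced metric; $\iota_{n_k}:M_{n_k}(\mathbb{F}_q)\to M(\mathbb{F}_q)$ is the canonical inclusion. An embedding is a unital isometric $\mathbb{F}_q$-algebra homomorphism. For maps $f,g:A\to B$ into a metric structure, $d(f,g)=\sup_{x\in A}d(f(x),g(x))$. A (not necessarily unital) homomorphism $\phi:M_m(\mathbb{F}_q)\to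 M_n(\mathbb{F}_q)$ is a $\delta$-embedding if there are a unit $y\in M_n(\mathbb{F}_q)$ and a nonnegative integer $k$ such that $\phi(x)=y(x^{\oplus k}\oplus 0^{n-mk})y^{-1}$ for every $x\in M_m(\mathbb{F}_q)$, and $\frac{mk}{n}\ge 1-\delta$. Here $x^{\oplus k}\oplus 0^{n-mk}$ is the block diagonal matrix with $k$ copies of $x$ followed by a zero block of size $n-mk$. *)

(* Defs.v *)
From HB Require Import structures.
From mathcomp Require Import all_boot all_order all_algebra generic_quotient.
From mathcomp Require Import boolp classical_sets reals topology normedtype.
From mathcomp Require Import sequences mxtens lra.

Set Implicit Arguments.
Unset Strict Implicit.
Unset Printing Implicit Defensive.

Import Order.TTheory GRing.Theory Num.Theory.
Import numFieldNormedType.Exports.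

Local Open Scope classical_set_scope.
Local Open Scope quotient_scope.
Local Open Scope ring_scope.

(* [dist] is a bare function, not that of the library's [metricType]: the latter
   brings a topology, and in the library a module with a topology must have
   scalars in a [numDomainType], whereas here [F] will be finite.  The axioms
   from [distDr] on hold for the normalized rank metric; they are what makes the
   algebra operations pass to direct limits and completions. *)
HB.mixin Record isMetricAlgebra (R : realType) (F : fieldType) A
    of GRing.Algebra F A := {
  dist : A -> A -> R ;
  distxx : forall x, dist x x = 0 ;
  dist_eq0 : forall x y, dist x y = 0 -> x = y ;
  dist_sym : forall x y, dist x y = dist y x ;
  dist_triangle : forall y x z, dist x z <= dist x y + dist y z ;
  distDr : forall z x y : A, dist (x + z) (y + z) = dist x y ;
  distMl : forall z x y : A, dist (z * x) (z * y) <= dist x y ;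
  distMr : forall z x y : A, dist (x * z) (y * z) <= dist x y ;
  distZ : forall (a : F) (x y : A), dist (a *: x) (a *: y) <= dist x y ;
  dist10 : dist 1 0 = 1
}.

#[short(type="metricAlgType")]
HB.structure Definition MetricAlgebra (R : realType) (F : fieldType) :=
  { A of isMetricAlgebra R F A & GRing.Algebra F A }.

Definition embedding (R : realType) (F : fieldType) (A B : metricAlgType R F)
    (f : A -> B) : Prop :=
  [/\ linear f, {morph f : x y / x * y}, f 1 = 1
    & forall x y, dist (f x) (f y) = dist x y].

Arguments embedding R {F A B} f.

Section MetricAlgebraTheory.
Context {R : realType} {F : fieldType} {A : metricAlgType R F}.
Implicit Types x y z : A.

Lemma dist_ge0 x y : 0 <= dist x y.
Proof.
have := dist_triangle y x x; rewrite distxx (dist_sym y x) -mulr2n.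
by rewrite pmulrn_lge0.
Qed.

Lemma distD x y x' y' : dist (x + y) (x' + y') <= dist x x' + dist y y'.
Proof.
apply: le_trans (dist_triangle (x' + y) _ _) _.
by rewrite distDr !(addrC x') distDr.
Qed.

Lemma distN x y : dist (- x) (- y) = dist x y.
Proof. by rewrite -(distDr (x + y)) addKr addrC addrK dist_sym. Qed.

Lemma distM x y x' y' : dist (x * y) (x' * y') <= dist x x' + dist y y'.
Proof.
apply: le_trans (dist_triangle (x' * y) _ _) _.
by apply: lerD; [exact: distMr | exact: distMl].
Qed.

Lemma dist_lip2 x y x' y' :
  `|dist x y - dist x' y'| <= dist x x' + dist y y'.
Proof.
have H a b a' b' : dist a b <= dist a a' + dist b b' + dist a' b'.
  apply: le_trans (dist_triangle a' _ _) _; rewrite -addrA lerD2l addrC.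
  by apply: le_trans (dist_triangle b' _ _) _; rewrite (dist_sym b').
rewrite ler_norml lerBrDr lerBlDr H andbT addrC lerBlDr addrC.
by rewrite (dist_sym x) (dist_sym y) H.
Qed.

End MetricAlgebraTheory.

(* Nonzero sizes are written [n.+1], because the library's [algType] requires
   1 != 0. *)
Section RankMetric.
Context (R : realType) (F : fieldType) (n : nat).
Local Notation M := 'M[F]_n.+1.
Implicit Types x y z : M.

Definition rank_dist x y : R := (\rank (x - y))%:R / n.+1%:R.

Lemma rank_distxx x : rank_dist x x = 0.
Proof. by rewrite /rank_dist subrr mxrank0 mul0r. Qed.

Lemma rank_dist_eq0 x y : rank_dist x y = 0 -> x = y.
Proof.
move=> /eqP; rewrite /rank_dist mulf_eq0 invr_eq0 !pnatr_eq0 orbF.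
by rewrite mxrank_eq0 subr_eq0 => /eqP.
Qed.

Lemma rank_dist_sym x y : rank_dist x y = rank_dist y x.
Proof. by rewrite /rank_dist -(mxrank_opp (x - y)) opprB. Qed.

Lemma rank_dist_le x y x' y' :
  (\rank (x - y)%R <= \rank (x' - y')%R)%N -> rank_dist x y <= rank_dist x' y'.
Proof. by move=> le; rewrite ler_wpM2r ?invr_ge0 ?ler_nat. Qed.

Lemma rank_dist_triangle y x z : rank_dist x z <= rank_dist x y + rank_dist y z.
Proof.
rewrite -mulrDl ler_wpM2r ?invr_ge0 // -natrD ler_nat.
by rewrite -[x - z](subrKA y) mxrank_add.
Qed.

Lemma rank_distDr z x y : rank_dist (x + z) (y + z) = rank_dist x y.
Proof. by rewrite /rank_dist opprD addrACA subrr addr0. Qed.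

Lemma rank_distMl z x y : rank_dist (z * x) (z * y) <= rank_dist x y.
Proof. by apply: rank_dist_le; rewrite -mulrBr mxrankM_maxr. Qed.

Lemma rank_distMr z x y : rank_dist (x * z) (y * z) <= rank_dist x y.
Proof. by apply: rank_dist_le; rewrite -mulrBl mxrankM_maxl. Qed.

Lemma rank_distZ (a : F) x y : rank_dist (a *: x) (a *: y) <= rank_dist x y.
Proof. by apply: rank_dist_le; rewrite -scalerBr mxrankS // scalemx_sub. Qed.

Lemma rank_dist10 : rank_dist 1 0 = 1.
Proof. by rewrite /rank_dist subr0 mxrank1 divff ?pnatr_eq0. Qed.

HB.instance Definition _ := isMetricAlgebra.Build R F M
  rank_distxx rank_dist_eq0 rank_dist_sym
  rank_dist_triangle rank_distDr rank_distMl rank_distMr rank_distZ rank_dist10.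
End RankMetric.

Section SeqQuotient.
Context {R : realType} {F : fieldType}.

(* Both the direct limit and the completion are obtained as follows: take a
   subalgebra [S] of the product of the [A k] such that [dist (x k) (y k)]
   converges for all [x], [y] in [S], use this limit as a pseudometric on [S],
   and identify the sequences at distance 0. *)
Record seq_subalgebra (A : nat -> metricAlgType R F) := SeqSubalgebra {
  subalg_mem :> (forall k, A k) -> Prop ;
  subalg1 : subalg_mem (fun=> 1) ;
  subalgD : forall x y, subalg_mem x -> subalg_mem y ->
    subalg_mem (fun k => x k + y k) ;
  subalgM : forall x y, subalg_mem x -> subalg_mem y ->
    subalg_mem (fun k => x k * y k) ;
  subalgZ : forall a x, subalg_mem x -> subalg_mem (fun k => a *: x k) ;
  subalg_cvg : forall x y, subalg_mem x -> subalg_mem y ->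
    cvgn (fun k => dist (x k) (y k))
}.

Context {A : nat -> metricAlgType R F} (S : seq_subalgebra A).

Record seq_in := SeqIn { seq_val :> forall k, A k ; seq_inP : S seq_val }.

HB.instance Definition _ := gen_eqMixin seq_in.
HB.instance Definition _ := gen_choiceMixin seq_in.

Definition seq_dist (x y : seq_in) : R := limn (fun k => dist (x k) (y k)).
Definition seq_eqv (x y : seq_in) : bool := seq_dist x y == 0.
Implicit Types x y z : seq_in.

Lemma seq_cvg x y : dist (x k) (y k) @[k --> \oo] --> seq_dist x y.
Proof. exact: (subalg_cvg (seq_inP x) (seq_inP y)). Qed.

Lemma seq_dist_lim x y l : dist (x k) (y k) @[k --> \oo] --> l -> seq_dist x y = l.
Proof. by move=> c; exact: (cvg_lim (@norm_hausdorff _ _) c). Qed.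

Lemma seq_dist_le x y x' y' :
  (forall k, dist (x k) (y k) <= dist (x' k) (y' k)) ->
  seq_dist x y <= seq_dist x' y'.
Proof.
move=> le; apply: ler_lim; [exact: (@seq_cvg x y)|exact: (@seq_cvg x' y')|].
by near=> k; exact: le.
Unshelve. all: by end_near. Qed.

Lemma seq_dist_leD x y x1 y1 x2 y2 :
  (forall k, dist (x k) (y k) <= dist (x1 k) (y1 k) + dist (x2 k) (y2 k)) ->
  seq_dist x y <= seq_dist x1 y1 + seq_dist x2 y2.
Proof.
move=> le; have c : dist (x1 k) (y1 k) + dist (x2 k) (y2 k) @[k --> \oo] -->
  seq_dist x1 y1 + seq_dist x2 y2 by exact: cvgD (@seq_cvg x1 y1) (@seq_cvg x2 y2).
rewrite -(cvg_lim (@norm_hausdorff _ _) c); apply: ler_lim; first exact: (@seq_cvg x y).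
  by apply/cvg_ex; exists (seq_dist x1 y1 + seq_dist x2 y2).
by near=> k; exact: le.
Unshelve. all: by end_near. Qed.

Lemma seq_dist_ge0 x y : 0 <= seq_dist x y.
Proof.
apply: limr_ge; first exact: (@seq_cvg x y).
by near=> k; exact: dist_ge0.
Unshelve. all: by end_near. Qed.

Lemma seq_distxx x : seq_dist x x = 0.
Proof. by rewrite /seq_dist; under eq_fun do rewrite distxx; rewrite lim_cst. Qed.

Lemma seq_dist_sym x y : seq_dist x y = seq_dist y x.
Proof. by rewrite /seq_dist; under eq_fun do rewrite dist_sym. Qed.

Lemma seq_dist_triangle y x z : seq_dist x z <= seq_dist x y + seq_dist y z.
Proof. by apply: seq_dist_leD => k; exact: dist_triangle. Qed.

Lemma seq_eqv_le x y r : r = 0 -> seq_dist x y <= r -> seq_eqv x y.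
Proof. by move=> -> le; rewrite /seq_eqv eq_le le seq_dist_ge0. Qed.

Lemma seq_eqv_equiv : equiv_class_of seq_eqv.
Proof.
split=> [x|x y|y x z]; rewrite /seq_eqv; first by rewrite seq_distxx.
  by rewrite seq_dist_sym.
move=> /eqP xy /eqP yz; apply: seq_eqv_le (seq_dist_triangle y x z).
by rewrite xy yz addr0.
Qed.

Canonical seq_eqv_rel := EquivRelPack seq_eqv_equiv.

Definition seq_quot : Type := {eq_quot seq_eqv_rel}.

HB.instance Definition _ := Choice.on seq_quot.
HB.instance Definition _ := EqQuotient.on seq_quot.

Definition seq_class x : seq_quot := \pi_seq_quot x.

Lemma seq_classP x y : reflect (seq_class x = seq_class y) (seq_eqv x y).
Proof. by apply: (iffP idP) => [?|/eqmodP//]; apply/eqmodP. Qed.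

Lemma seq_class_ext x y : (forall k, x k = y k) -> seq_class x = seq_class y.
Proof.
move=> xy; apply/seq_classP; apply/eqP; rewrite -(seq_distxx x).
by rewrite /seq_dist; under eq_fun do rewrite -xy.
Qed.

Lemma seq_reprK x : seq_dist (repr (seq_class x)) x = 0.
Proof. by apply/eqP/seq_classP; rewrite /seq_class reprK. Qed.

Lemma seq_quotP (P : seq_quot -> Prop) : (forall x, P (seq_class x)) -> forall q, P q.
Proof. by move=> Px q; rewrite -[q]reprK; exact: Px. Qed.

Definition seq_one := SeqIn (subalg1 S).
Definition seq_add x y := SeqIn (subalgD (seq_inP x) (seq_inP y)).
Definition seq_mul x y := SeqIn (subalgM (seq_inP x) (seq_inP y)).
Definition seq_scale a x := SeqIn (subalgZ a (seq_inP x)).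

Definition quot_one := seq_class seq_one.
Definition quot_scale a (p : seq_quot) := seq_class (seq_scale a (repr p)).
Definition quot_add (p q : seq_quot) := seq_class (seq_add (repr p) (repr q)).
Definition quot_mul (p q : seq_quot) := seq_class (seq_mul (repr p) (repr q)).
Definition quot_zero := quot_scale 0 quot_one.
Definition quot_opp p := quot_scale (-1) p.
Definition quot_dist (p q : seq_quot) := seq_dist (repr p) (repr q).

Lemma quot_scaleE a x : quot_scale a (seq_class x) = seq_class (seq_scale a x).
Proof.
apply/seq_classP; apply: (seq_eqv_le (seq_reprK x)).
by apply: seq_dist_le => k; exact: distZ.
Qed.

Lemma quot_addE x y :
  quot_add (seq_class x) (seq_class y) = seq_class (seq_add x y).
Proof.
apply/seq_classP; apply: (seq_eqv_le (r := seq_dist _ x + seq_dist _ y)); last first.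
  by apply: seq_dist_leD => k; exact: distD.
by rewrite !seq_reprK addr0.
Qed.

Lemma quot_mulE x y :
  quot_mul (seq_class x) (seq_class y) = seq_class (seq_mul x y).
Proof.
apply/seq_classP; apply: (seq_eqv_le (r := seq_dist _ x + seq_dist _ y)); last first.
  by apply: seq_dist_leD => k; exact: distM.
by rewrite !seq_reprK addr0.
Qed.

Lemma quot_distE x y : quot_dist (seq_class x) (seq_class y) = seq_dist x y.
Proof.
rewrite /quot_dist; set x' := repr _; set y' := repr _.
apply: le_anti; apply/andP; split.
  apply: le_trans (seq_dist_triangle x _ _) _.
  rewrite seq_reprK add0r; apply: le_trans (seq_dist_triangle y _ _) _.
  by rewrite (seq_dist_sym y) seq_reprK addr0.
apply: le_trans (seq_dist_triangle x' _ _) _.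
rewrite seq_dist_sym seq_reprK add0r; apply: le_trans (seq_dist_triangle y' _ _) _.
by rewrite seq_reprK addr0.
Qed.

Definition quotE := (quot_scaleE, quot_addE, quot_mulE, quot_distE).

Lemma quot_addA : associative quot_add.
Proof.
elim/seq_quotP=> x; elim/seq_quotP=> y; elim/seq_quotP=> z; rewrite !quotE.
by apply: seq_class_ext => k /=; rewrite addrA.
Qed.
Lemma quot_addC : commutative quot_add.
Proof.
elim/seq_quotP=> x; elim/seq_quotP=> y; rewrite !quotE.
by apply: seq_class_ext => k /=; rewrite addrC.
Qed.
Lemma quot_add0 : left_id quot_zero quot_add.
Proof.
elim/seq_quotP=> x; rewrite /quot_zero !quotE.
by apply: seq_class_ext => k /=; rewrite scale0r add0r.
Qed.
Lemma quot_addN : left_inverse quot_zero quot_opp quot_add.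
Proof.
elim/seq_quotP=> x; rewrite /quot_zero /quot_opp !quotE.
by apply: seq_class_ext => k /=; rewrite scaleN1r scale0r addNr.
Qed.

HB.instance Definition _ :=
  GRing.isZmodule.Build seq_quot quot_addA quot_addC quot_add0 quot_addN.

Lemma quot_mulA : associative quot_mul.
Proof.
elim/seq_quotP=> x; elim/seq_quotP=> y; elim/seq_quotP=> z; rewrite !quotE.
by apply: seq_class_ext => k /=; rewrite mulrA.
Qed.
Lemma quot_mul1l : left_id quot_one quot_mul.
Proof.
by elim/seq_quotP=> x; rewrite !quotE; apply: seq_class_ext => k /=; rewrite mul1r.
Qed.
Lemma quot_mul1r : right_id quot_one quot_mul.
Proof.
by elim/seq_quotP=> x; rewrite !quotE; apply: seq_class_ext => k /=; rewrite mulr1.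
Qed.
Lemma quot_mulDl : left_distributive quot_mul quot_add.
Proof.
elim/seq_quotP=> x; elim/seq_quotP=> y; elim/seq_quotP=> z; rewrite !quotE.
by apply: seq_class_ext => k /=; rewrite mulrDl.
Qed.
Lemma quot_mulDr : right_distributive quot_mul quot_add.
Proof.
elim/seq_quotP=> x; elim/seq_quotP=> y; elim/seq_quotP=> z; rewrite !quotE.
by apply: seq_class_ext => k /=; rewrite mulrDr.
Qed.
Lemma quot_dist10 : quot_dist quot_one quot_zero = 1.
Proof.
rewrite /quot_zero !quotE; apply: seq_dist_lim => /=.
by under eq_fun do rewrite scale0r dist10; exact: cvg_cst.
Qed.
Lemma quot_one_neq0 : quot_one != quot_zero.
Proof.
apply/eqP => e; have := quot_dist10; rewrite -e /quot_dist seq_distxx.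
by move/eqP; rewrite eq_sym oner_eq0.
Qed.

HB.instance Definition _ := GRing.Zmodule_isNzRing.Build seq_quot
  quot_mulA quot_mul1l quot_mul1r quot_mulDl quot_mulDr quot_one_neq0.

Lemma quot_scaleA a b p : quot_scale a (quot_scale b p) = quot_scale (a * b) p.
Proof.
elim/seq_quotP: p => x; rewrite !quotE.
by apply: seq_class_ext => k /=; rewrite scalerA.
Qed.
Lemma quot_scale1 : left_id 1 quot_scale.
Proof.
by elim/seq_quotP=> x; rewrite !quotE; apply: seq_class_ext => k /=; rewrite scale1r.
Qed.
Lemma quot_scaleDr : right_distributive quot_scale +%R.
Proof.
move=> a; elim/seq_quotP=> x; elim/seq_quotP=> y; rewrite /GRing.add /= !quotE.
by apply: seq_class_ext => k /=; rewrite scalerDr.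
Qed.
Lemma quot_scaleDl p : {morph quot_scale^~ p : a b / a + b}.
Proof.
elim/seq_quotP: p => x a b; rewrite [RHS]/GRing.add /= !quotE.
by apply: seq_class_ext => k /=; rewrite scalerDl.
Qed.

HB.instance Definition _ := GRing.Zmodule_isLmodule.Build F seq_quot
  quot_scaleA quot_scale1 quot_scaleDr quot_scaleDl.

Lemma quot_scaleAl (a : F) (p q : seq_quot) : a *: (p * q) = (a *: p) * q.
Proof.
elim/seq_quotP: p => x; elim/seq_quotP: q => y.
rewrite /GRing.mul /GRing.scale /= !quotE.
by apply: seq_class_ext => k /=; rewrite scalerAl.
Qed.
HB.instance Definition _ := GRing.Lmodule_isLalgebra.Build F seq_quot quot_scaleAl.

Lemma quot_scaleAr (a : F) (p q : seq_quot) : a *: (p * q) = p * (a *: q).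
Proof.
elim/seq_quotP: p => x; elim/seq_quotP: q => y.
rewrite /GRing.mul /GRing.scale /= !quotE.
by apply: seq_class_ext => k /=; rewrite scalerAr.
Qed.
HB.instance Definition _ := GRing.Lalgebra_isAlgebra.Build F seq_quot quot_scaleAr.

Lemma quot_distxx p : quot_dist p p = 0.
Proof. exact: seq_distxx. Qed.
Lemma quot_dist_eq0 p q : quot_dist p q = 0 -> p = q.
Proof.
elim/seq_quotP: p => x; elim/seq_quotP: q => y; rewrite quotE => xy.
by apply/seq_classP/eqP.
Qed.
Lemma quot_dist_sym p q : quot_dist p q = quot_dist q p.
Proof. exact: seq_dist_sym. Qed.
Lemma quot_dist_triangle q p r : quot_dist p r <= quot_dist p q + quot_dist q r.
Proof. exact: seq_dist_triangle. Qed.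
Lemma quot_distDr (r p q : seq_quot) : quot_dist (p + r) (q + r) = quot_dist p q.
Proof.
elim/seq_quotP: p => x; elim/seq_quotP: q => y; elim/seq_quotP: r => z.
rewrite /GRing.add /= !quotE /seq_dist /=.
by under eq_fun do rewrite distDr.
Qed.
Lemma quot_distMl (r p q : seq_quot) : quot_dist (r * p) (r * q) <= quot_dist p q.
Proof.
elim/seq_quotP: p => x; elim/seq_quotP: q => y; elim/seq_quotP: r => z.
rewrite /GRing.mul /= !quotE; apply: seq_dist_le => k; exact: distMl.
Qed.
Lemma quot_distMr (r p q : seq_quot) : quot_dist (p * r) (q * r) <= quot_dist p q.
Proof.
elim/seq_quotP: p => x; elim/seq_quotP: q => y; elim/seq_quotP: r => z.
rewrite /GRing.mul /= !quotE; apply: seq_dist_le => k; exact: distMr.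
Qed.
Lemma quot_distZ (a : F) (p q : seq_quot) :
  quot_dist (a *: p) (a *: q) <= quot_dist p q.
Proof.
elim/seq_quotP: p => x; elim/seq_quotP: q => y.
rewrite /GRing.scale /= !quotE; apply: seq_dist_le => k; exact: distZ.
Qed.

HB.instance Definition _ := isMetricAlgebra.Build R F seq_quot
  quot_distxx quot_dist_eq0 quot_dist_sym quot_dist_triangle
  quot_distDr quot_distMl quot_distMr quot_distZ quot_dist10.

Lemma dist_seq_class x y : dist (seq_class x) (seq_class y) = seq_dist x y.
Proof. exact: quot_distE. Qed.

End SeqQuotient.

Section Amplification.
Context {F : fieldType}.

Lemma tensmx1 m d : (1%:M : 'M[F]_m) *t (1%:M : 'M[F]_d) = 1%:M.
Proof.
apply/matrixP => i j.
case: (mxtens_indexP i) => i0 i1; case: (mxtens_indexP j) => j0 j1.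
by rewrite tensmxE !mxE -natrM mulnb (can_eq (@mxtens_indexK _ _)) xpair_eqE.
Qed.

Lemma pid_tensmx1 m d r : (pid_mx r : 'M[F]_m) *t (1%:M : 'M[F]_d) = pid_mx (r * d).
Proof.
apply/matrixP => i j.
case: (mxtens_indexP i) => i0 i1; case: (mxtens_indexP j) => j0 j1.
rewrite tensmxE !mxE -natrM mulnb /= eq_addl_mul ?ltn_ord // xpair_eqE andbAC.
congr (_ && _)%:R.
have d0 : (0 < d)%N by apply: leq_ltn_trans (ltn_ord i1).
apply/idP/idP => [lt|].
  apply: leq_trans (leq_mul lt (leqnn d)).
  by rewrite mulSn addnC ltn_add2r.
by apply: contraTT; rewrite -!leqNgt => le; rewrite (leq_trans (leq_mul le (leqnn d))) ?leq_addr.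
Qed.

Lemma mxrank_tensmx1 m d (x : 'M[F]_m) :
  \rank (x *t (1%:M : 'M[F]_d)) = (\rank x * d)%N.
Proof.
case: d => [|d].
  rewrite [RHS]muln0; apply/eqP; rewrite -leqn0 -[leqRHS](muln0 m).
  exact: rank_leq_row.
case: m x => [|m] x.
  rewrite [x in RHS]flatmx0 mxrank0; apply/eqP; rewrite -leqn0.
  exact: rank_leq_row.
have u A B : A \in unitmx -> B \in unitmx ->
    ((A : 'M[F]_m.+1) *t (B : 'M[F]_d.+1)) \in unitmx by exact: tensmx_unit.
have -> : x *t (1%:M : 'M[F]_d.+1) =
    (col_ebase x *t (1%:M : 'M_d.+1)) *m (pid_mx (\rank x) *t (1%:M : 'M_d.+1))
    *m (row_ebase x *t (1%:M : 'M_d.+1)).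
  by rewrite !tensmx_mul !mulmx1 mulmx_ebase.
rewrite mxrankMfree ?row_free_unit ?u ?row_ebase_unit ?unitmx1 //.
rewrite eqmxMfull ?row_full_unit ?u ?col_ebase_unit ?unitmx1 //.
by rewrite pid_tensmx1 rank_pid_mx // leq_mul2r rank_leq_row orbT.
Qed.

Lemma amplify_size m n : (m %| n)%N -> (m * (n %/ m))%N = n.
Proof. by move=> mn; rewrite mulnC divnK. Qed.

(* x \otimes 1_(n/m), that is, each entry a of x becomes the block a%:M of size
   n %/ m; the cast only retypes m * (n %/ m) as n. *)
Definition amplify m n (mn : (m %| n)%N) (x : 'M[F]_m) : 'M[F]_n :=
  castmx (amplify_size mn, amplify_size mn) (x *t (1%:M : 'M[F]_(n %/ m))).

Section Cast.
Context (m d n : nat) (e : (m * d)%N = n).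
Local Notation amp x := (castmx (e, e) (x *t (1%:M : 'M[F]_d))).
Implicit Types x y : 'M[F]_m.

Lemma amp_linear a x y : amp (a *: x + y) = a *: amp x + amp y.
Proof.
case: n / e; rewrite !castmx_id; apply/matrixP => i j.
case: (mxtens_indexP i) => i0 i1; case: (mxtens_indexP j) => j0 j1.
rewrite tensmxE [RHS]mxE [X in _ = X + _]mxE !tensmxE !mxE.
by rewrite mulrDl mulrA.
Qed.

Lemma amp_mul x y : amp (x *m y) = amp x *m amp y.
Proof. by case: n / e; rewrite !castmx_id tensmx_mul mulmx1. Qed.

Lemma amp_1 : amp 1%:M = 1%:M.
Proof. by case: n / e; rewrite castmx_id tensmx1. Qed.

Lemma amp_sub x y : amp x - amp y = amp (x - y).
Proof. by rewrite addrC -scaleN1r -amp_linear scaleN1r addrC. Qed.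

Lemma amp_rank x : \rank (amp x) = (\rank x * d)%N.
Proof. by case: n / e; rewrite castmx_id mxrank_tensmx1. Qed.
End Cast.

End Amplification.

Section DirectLimit.
Context {R : realType} {F : fieldType} (A : nat -> metricAlgType R F).
Context (f : forall k, A k -> A k.+1) (fE : forall k, embedding R (@f k)).

(* The direct limit consists of the eventually coherent sequences.  Since each
   [f k] is isometric, the distance between two of them is eventually constant;
   thus they are identified iff they are eventually equal, and the metric is the
   one induced by the [A k]. *)
Definition coherent (x : forall k, A k) : Prop :=
  exists N, forall k, (N <= k)%N -> x k.+1 = f (x k).

Lemma coherent1 : coherent (fun=> 1).
Proof. by exists 0%N => k _; have [_ _ -> _] := fE k. Qed.

Lemma coherentD x y : coherent x -> coherent y -> coherent (fun k => x k + y k).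
Proof.
move=> [N xN] [N' yN]; exists (maxn N N') => k; rewrite geq_max => /andP[/xN-> /yN->].
by have [l _ _ _] := fE k; have := l 1 (x k) (y k); rewrite !scale1r => ->.
Qed.

Lemma coherentM x y : coherent x -> coherent y -> coherent (fun k => x k * y k).
Proof.
move=> [N xN] [N' yN]; exists (maxn N N') => k; rewrite geq_max => /andP[/xN-> /yN->].
by have [_ -> _ _] := fE k.
Qed.

Lemma embeddingZ k a (x : A k) : f (a *: x) = a *: f x.
Proof.
have [l _ _ _] := fE k; have f0 : @f k 0 = 0.
  by have := l 1 0 0; rewrite !scale1r addr0 => /eqP; rewrite -subr_eq subrr => /eqP <-.
by have := l a x 0; rewrite f0 !addr0.
Qed.

Lemma coherentZ a x : coherent x -> coherent (fun k => a *: x k).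
Proof. by move=> [N xN]; exists N => k /xN->; rewrite embeddingZ. Qed.

Lemma coherent_dist x y : coherent x -> coherent y ->
  exists N, forall k, (N <= k)%N -> dist (x k) (y k) = dist (x N) (y N).
Proof.
move=> [N xN] [N' yN]; exists (maxn N N') => k /subnK <-.
elim: (k - _)%N => [//|i IH]; rewrite addSn -IH.
have [_ _ _ <-] := fE (i + maxn N N').
by rewrite xN ?yN // (leq_trans _ (leq_addl _ _)) // ?leq_maxl ?leq_maxr.
Qed.

Lemma coherent_dist_cvg x y : coherent x -> coherent y ->
  exists N, dist (x k) (y k) @[k --> \oo] --> dist (x N) (y N).
Proof.
move=> cx cy; have [N xy] := coherent_dist cx cy; exists N.
apply: cvg_near_cst; exists N => // k /= Nk; exact: xy.
Qed.

Lemma coherent_cvg x y : coherent x -> coherent y ->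
  cvgn (fun k => dist (x k) (y k)).
Proof. by move=> cx cy; have [N] := coherent_dist_cvg cx cy; apply: cvgP. Qed.

Definition coherent_subalgebra : seq_subalgebra A :=
  SeqSubalgebra coherent1 coherentD coherentM coherentZ coherent_cvg.

Definition dirlim : metricAlgType R F := seq_quot coherent_subalgebra.

(* [transport x j] is the image of [x : A k] in [A j] if [k <= j], and 0 otherwise. *)
Fixpoint transport k (x : A k) (j : nat) : A j :=
  match @eqP _ k j with
  | ReflectT e => ecast i (A i) e x
  | ReflectF _ => if j is i.+1 then f (transport x i) else 0
  end.

Lemma transport_id k (x : A k) : transport x k = x.
Proof.
by case: k x => [|k] x /=; case: eqP => // e; rewrite (eq_irrelevance e erefl).
Qed.

Lemma transportS k (x : A k) j : (k <= j)%N -> transport x j.+1 = f (transport x j).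
Proof. by move=> kj; rewrite /=; case: eqP => // e; rewrite e ltnn in kj. Qed.

Lemma coherent_transport k (x : A k) : coherent (transport x).
Proof. by exists k => j; exact: transportS. Qed.

Definition dirlim_in k (x : A k) : dirlim :=
  seq_class (SeqIn (S := coherent_subalgebra) (coherent_transport x)).

Lemma dirlim_eq (x y : seq_in coherent_subalgebra) :
  (exists N, forall k, (N <= k)%N -> x k = y k) -> seq_class x = seq_class y.
Proof.
move=> [N xy]; apply/seq_classP/eqP/seq_dist_lim; apply: cvg_near_cst.
by exists N => // k /= /xy ->; rewrite distxx.
Qed.

Lemma dirlim_inS k (x : A k) : dirlim_in (f x) = dirlim_in x.
Proof.
apply: dirlim_eq; exists k.+1 => j /subnK <- /=; elim: (j - _)%N => [|i IH].
  by rewrite add0n transport_id transportS // transport_id.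
by rewrite addSn !transportS ?IH ?leq_addl // (leq_trans (leqnSn _)) ?leq_addl.
Qed.

Lemma dirlim_in_surj (p : dirlim) : exists k (x : A k), p = dirlim_in x.
Proof.
move: p; apply: seq_quotP => x; have [N xN] := seq_inP x; exists N, (x N).
apply: dirlim_eq; exists N => j /subnK <- /=; elim: (j - _)%N => [|i IH].
  by rewrite add0n transport_id.
by rewrite addSn transportS ?leq_addl // -IH -xN // leq_addl.
Qed.

Lemma dirlim_in_embedding k : embedding R (@dirlim_in k).
Proof.
split.
- move=> a x y; rewrite /dirlim_in /GRing.scale /GRing.add /= !quotE.
  apply: dirlim_eq; exists k => j /subnK <- /=; elim: (j - _)%N => [|i IH].
    by rewrite add0n !transport_id.
  by rewrite addSn !transportS ?leq_addl // IH; have [-> _ _ _] := fE (i + k).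
- move=> x y; rewrite /dirlim_in /GRing.mul /= !quotE.
  apply: dirlim_eq; exists k => j /subnK <- /=; elim: (j - _)%N => [|i IH].
    by rewrite add0n !transport_id.
  by rewrite addSn !transportS ?leq_addl // IH; have [_ -> _ _] := fE (i + k).
- apply: dirlim_eq; exists k => j /subnK <- /=; elim: (j - _)%N => [|i IH].
    by rewrite add0n !transport_id.
  by rewrite addSn !transportS ?leq_addl // IH; have [_ _ -> _] := fE (i + k).
- move=> x y; apply: etrans (dist_seq_class _ _) _; apply: seq_dist_lim.
  apply: cvg_near_cst; exists k => // j /= /subnK <-; elim: (j - _)%N => [|i IH].
    by rewrite add0n !transport_id.
  by rewrite addSn !transportS ?leq_addl //; have [_ _ _ ->] := fE (i + k).
Qed.

End DirectLimit.

Section Completion.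
Context {R : realType} {F : fieldType} (A : metricAlgType R F).

Definition cauchy_seq (x : nat -> A) : Prop :=
  forall e : R, 0 < e ->
  exists N, forall i j, (N <= i)%N -> (N <= j)%N -> dist (x i) (x j) < e.

Lemma cauchy_cst a : cauchy_seq (fun=> a).
Proof. by move=> e e0; exists 0%N => i j _ _; rewrite distxx. Qed.

Lemma cauchy_le2 (z x y : nat -> A) : cauchy_seq x -> cauchy_seq y ->
  (forall i j, dist (z i) (z j) <= dist (x i) (x j) + dist (y i) (y j)) ->
  cauchy_seq z.
Proof.
move=> cx cy le e e0; have e2 : 0 < e / 2 by rewrite divr_gt0.
have [N xN] := cx _ e2; have [N' yN] := cy _ e2.
exists (maxn N N') => i j; rewrite !geq_max => /andP[Ni Ni'] /andP[Nj Nj'].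
by apply: le_lt_trans (le _ _) _; rewrite [e]splitr ltrD ?xN ?yN.
Qed.

Lemma cauchyD x y : cauchy_seq x -> cauchy_seq y -> cauchy_seq (fun k => x k + y k).
Proof. by move=> cx cy; apply: cauchy_le2 cx cy _ => i j; exact: distD. Qed.

Lemma cauchyM x y : cauchy_seq x -> cauchy_seq y -> cauchy_seq (fun k => x k * y k).
Proof. by move=> cx cy; apply: cauchy_le2 cx cy _ => i j; exact: distM. Qed.

Lemma cauchyZ a x : cauchy_seq x -> cauchy_seq (fun k => a *: x k).
Proof.
move=> cx; apply: (cauchy_le2 cx (cauchy_cst 0)) => i j.
by rewrite distxx addr0 distZ.
Qed.

Lemma cauchy_dist_cvg x y : cauchy_seq x -> cauchy_seq y ->
  cvgn (fun k => dist (x k) (y k)).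
Proof.
move=> cx cy; apply/cauchy_cvgP/cauchy_ballP => e e0.
have e2 : 0 < e / 2 by rewrite divr_gt0.
have [N xN] := cx _ e2; have [N' yN] := cy _ e2.
pose M := [set k | (maxn N N' <= k)%N].
have nM : (\oo : set_system nat) M by exists (maxn N N').
exists ((fun k => dist (x k) (y k)) @` M, (fun k => dist (x k) (y k)) @` M).
  by split; apply: filterS nM => k Mk; exists k.
move=> [_ _] /= [[i + <-] [j + <-]]; rewrite /M /= !geq_max.
move=> /andP[Ni Ni'] /andP[Nj Nj'].
have H : `|dist (x i) (y i) - dist (x j) (y j)| < (e : R).
  by apply: le_lt_trans (dist_lip2 _ _ _ _) _; rewrite [ltRHS]splitr ltrD ?xN ?yN.
by rewrite -ball_normE.
Qed.

Definition cauchy_subalgebra : seq_subalgebra (fun=> A) :=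
  SeqSubalgebra (cauchy_cst 1) cauchyD cauchyM cauchyZ cauchy_dist_cvg.

Definition completion : metricAlgType R F := seq_quot cauchy_subalgebra.

Definition completion_in (a : A) : completion :=
  seq_class (SeqIn (S := cauchy_subalgebra) (cauchy_cst a)).

Lemma completion_in_embedding : embedding R completion_in.
Proof.
split.
- move=> a x y; rewrite /completion_in /GRing.scale /GRing.add /= !quotE.
  exact: seq_class_ext.
- move=> x y; rewrite /completion_in /GRing.mul /= !quotE; exact: seq_class_ext.
- exact: seq_class_ext.
- move=> x y; apply: etrans (dist_seq_class _ _) _; apply: seq_dist_lim.
  by rewrite /=; exact: cvg_cst.
Qed.

Lemma completion_cvg (x : seq_in cauchy_subalgebra) (e : R) : 0 < e ->
  exists N, forall k, (N <= k)%N -> dist (completion_in (x k)) (seq_class x) < e.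
Proof.
move=> e0; have e2 : 0 < e / 2 by rewrite divr_gt0.
have cx : cauchy_seq x := seq_inP x.
have [N xN] := cx _ e2; exists N => k Nk.
rewrite [ltLHS]dist_seq_class; apply: (@le_lt_trans _ _ (e / 2)); last first.
  by rewrite ltr_pdivrMr // ltr_pMr // ltr1n.
apply: limr_le; first exact: cauchy_dist_cvg (cauchy_cst _) cx.
by exists N => // j /= Nj; apply/ltW/xN.
Qed.

Lemma completion_in_dense (p : completion) (e : R) : 0 < e ->
  exists a, dist (completion_in a) p < e.
Proof.
move=> e0; move: p; apply: seq_quotP => x; have [N xN] := completion_cvg x e0.
by exists (x N); exact: xN.
Qed.
End Completion.

Lemma completion_complete (R : realType) (F : fieldType) (A : metricAlgType R F)
    (u : nat -> completion A) : cauchy_seq u ->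
  exists l, forall e : R, 0 < e ->
  exists N, forall k, (N <= k)%N -> dist (u k) l < e.
Proof.
move=> cu.
have h0 k : 0 < k.+1%:R^-1 :> R by rewrite invr_gt0.
pose a k := projT1 (cid (completion_in_dense (u k) (h0 k))).
have aP k : dist (completion_in (a k)) (u k) < k.+1%:R^-1.
  exact: projT2 (cid (completion_in_dense (u k) (h0 k))).
have small (e : R) : 0 < e -> exists N, forall k, (N <= k)%N -> k.+1%:R^-1 < e.
  move=> e0; exists (Num.truncn e^-1) => k lek.
  rewrite invf_plt ?posrE //; apply: lt_le_trans (truncnS_gt _) _.
  by rewrite ler_nat ltnS.
have ca : cauchy_seq a.
  move=> e e0; have e3 : 0 < e / 3 by rewrite divr_gt0.
  have [N uN] := cu _ e3; have [N' sN] := small _ e3.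
  exists (maxn N N') => i j; rewrite !geq_max => /andP[Ni Ni'] /andP[Nj Nj'].
  have [_ _ _ <-] := completion_in_embedding A.
  apply: le_lt_trans (dist_triangle (u i) _ _) _.
  have -> : e = e / 3 + (e / 3 + e / 3) by lra.
  apply: ltrD; first exact: lt_trans (aP i) (sN _ Ni').
  apply: le_lt_trans (dist_triangle (u j) _ _) _.
  by apply: ltrD; [exact: uN | rewrite dist_sym; exact: lt_trans (aP j) (sN _ Nj')].
exists (seq_class (SeqIn (S := cauchy_subalgebra A) ca)) => e e0.
have e2 : 0 < e / 2 by rewrite divr_gt0.
have [N sN] := small _ e2; have [N' aN] := completion_cvg (SeqIn (S := cauchy_subalgebra A) ca) e2.
exists (maxn N N') => k; rewrite geq_max => /andP[Nk Nk'].
apply: le_lt_trans (dist_triangle (completion_in (a k)) _ _) _.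
rewrite [e]splitr ltrD //; last exact: aN.
by rewrite dist_sym; exact: lt_trans (aP k) (sN _ Nk).
Qed.

Lemma amplify_embedding (R : realType) (F : fieldType) (m n : nat)
    (mn : (m.+1 %| n.+1)%N) : embedding R (@amplify F m.+1 n.+1 mn).
Proof.
split; [exact: amp_linear | exact: amp_mul | exact: amp_1 |].
move=> x y; rewrite /dist /= /rank_dist amp_sub amp_rank.
have e : n.+1%:R = m.+1%:R * (n.+1 %/ m.+1)%:R :> R.
  by rewrite -natrM amplify_size.
have n0 : (n.+1 %/ m.+1)%:R != 0 :> R.
  by apply: contraTneq (ltn0Sn n) => e0; rewrite -(ltr0n R) e e0 mulr0 ltxx.
by rewrite natrM [X in _ / X]e -mulf_div divff // mulr1.
Qed.

(* Terms are positive by construction: the k-th term is [(fs_pred k).+1]. *)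
Record factor_seq := FactorSeq {
  fs_pred : nat -> nat ;
  fs_dvd : forall k, ((fs_pred k).+1 %| (fs_pred k.+1).+1)%N ;
  fs_cvg : (fs_pred k).+1 @[k --> \oo] --> \oo
}.

Definition fs_term (s : factor_seq) (k : nat) : nat := (fs_pred s k).+1.
Coercion fs_term : factor_seq >-> Funclass.

Section LimitAlgebra.
Context (R : realType) (F : fieldType) (s : factor_seq).

Definition matrix_tower (k : nat) : metricAlgType R F := 'M[F]_(s k).

Definition tower_map (k : nat) : matrix_tower k -> matrix_tower k.+1 :=
  amplify (fs_dvd s k).

Lemma tower_map_embedding (k : nat) : embedding R (@tower_map k).
Proof. exact: amplify_embedding. Qed.

Definition limit_algebra : metricAlgType R F :=
  completion (dirlim tower_map_embedding).

Definition limit_in (k : nat) (x : 'M[F]_(s k)) : limit_algebra :=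
  completion_in (dirlim_in tower_map_embedding (x : matrix_tower k)).

Lemma limit_in_embedding (k : nat) : embedding R (@limit_in k).
Proof.
have [dl dM d1 dd] := dirlim_in_embedding tower_map_embedding k.
have [cl cM c1 cd] := completion_in_embedding (dirlim tower_map_embedding).
split=> [a x y|x y||x y].
- by apply: etrans (cl a _ _); congr completion_in; exact: dl.
- by apply: etrans (cM _ _); congr completion_in; exact: dM.
- by apply: etrans c1; congr completion_in; exact: d1.
- by apply: etrans (cd _ _) _; exact: dd.
Qed.

Lemma limit_inS (k : nat) (x : 'M[F]_(s k)) :
  limit_in (k := k.+1) (amplify (fs_dvd s k) x) = limit_in x.
Proof. by congr completion_in; exact: dirlim_inS. Qed.

Lemma limit_in_dense (p : limit_algebra) (e : R) : 0 < e ->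
  exists k (x : 'M[F]_(s k)), dist (limit_in x) p < e.
Proof.
move=> e0; have [a] := completion_in_dense p e0.
by have [k [x ->]] := dirlim_in_surj a; exists k, x.
Qed.
End LimitAlgebra.
Arguments limit_in R {F} s k x.

(* The supremum is meant for bounded families; on a finite [A] it is a maximum. *)
Definition map_dist (R : realType) (F : fieldType) (A : Type)
    (B : metricAlgType R F) (f g : A -> B) : R :=
  sup (range (fun x => dist (f x) (g x))).

(* The existence of [e] amounts to [m * k <= n]. *)
Definition delta_embedding (R : realType) (F : fieldType) (m n : nat) (delta : R)
    (f : 'M[F]_m -> 'M[F]_n) : Prop :=
  [/\ linear f, {morph f : x y / x *m y}
    & exists (y : 'M[F]_n) (k : nat)
        (e : (\sum_(i < k) m + (n - m * k) = n)%N),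
      [/\ y \in unitmx,
          forall x, f x =
            y *m castmx (e, e) (block_mx (\mxdiag_(i < k) x) 0 0 0) *m invmx y
        & 1 - delta <= (m * k)%:R / n%:R]].

(* Main.v *)
(* Approximate phi on the matrix units by elements a_ij of M_(n_N), extend
   linearly to alpha : M_n -> M_(n_K) for K >= N, and let W be the subspace of
   those row vectors v with v alpha(1) = v and
   v alpha(z) (alpha(x) alpha(y) - alpha(xy)) = 0 for all x, y, z.  Its
   codimension is a small multiple of n_K, it is stable under alpha, and alpha
   makes it a genuine unital right M_n-module; so it has a basis consisting of
   the blocks (b_t alpha(E_0k))_k, with b_t a basis of W alpha(E_00).  Completing
   this basis to one of the whole space and acting on the first mn basis vectors
   by m diagonal blocks gives psi, which agrees with alpha on W. *)
From HB Require Import structures.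
Require Import Defs.
From mathcomp Require Import all_boot all_order all_algebra.
From mathcomp Require Import reals.
From mathcomp Require Import boolp classical_sets zify lra.

Set Implicit Arguments.
Unset Strict Implicit.
Unset Printing Implicit Defensive.

Import Order.TTheory GRing.Theory Num.Theory.
Local Open Scope ring_scope.

(** * Completing independent rows to a basis; rows of block diagonal products *)

Lemma extend_row_free (F : fieldType) (p n : nat) (G : 'M[F]_(p, n)) :
  row_free G ->
  exists2 Y : 'M[F]_n, Y \in unitmx &
    forall (i : 'I_p) (j : 'I_n), i = j :> nat -> row j Y = row i G.
Proof.
move=> freeG; have pn : (p <= n)%N by rewrite -(eqP freeG) rank_leq_col.
move: G freeG; rewrite -(subnKC pn); move: (n - p)%N => q G freeG.
(* A free [G] is [col_ebase G] times the first [p] rows of [row_ebase G]; bordering [col_ebase G] by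
   an identity block supplies the remaining rows. *)
exists (block_mx (col_ebase G) 0 0 1%:M *m row_ebase G).
  rewrite unitmx_mul row_ebase_unit unitmxE det_ublock det1 mulr1.
  by rewrite -unitmxE col_ebase_unit.
move=> i j ij; have -> : j = lshift q i by apply: val_inj.
rewrite -row_usubmx -mul_usub_mx /block_mx col_mxKu; congr (row i _).
rewrite -[G in RHS]mulmx_ebase (eqP freeG) pid_mx_row.
by rewrite mul_mx_row mulmx1 mulmx0.
Qed.

Lemma Rank_const (m d : nat) (t : 'I_m) (k : 'I_d) :
  @tagnat.Rank m (fun=> d) t k = (t * d + k)%N :> nat.
Proof.
rewrite tagnat.RankEsum; congr (_ + _)%N.
by rewrite (big_ord_narrow (ltnW (ltn_ord t))) sum_nat_const card_ord.
Qed.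

(** Row positions are compared as natural numbers, so that the cast along [e] can be eliminated. *)
Lemma row_diag_mul (F : fieldType) (d m r L : nat) (x : 'M[F]_d)
    (e : (\sum_(i < m) d + r = L)%N) (Z : 'M[F]_L) (G : 'M_(d, L)) (t : 'I_m) :
  (forall (k : 'I_d) (j : 'I_L), j = (t * d + k)%N :> nat ->
    row j Z = row k G) ->
  forall (k : 'I_d) (j : 'I_L), j = (t * d + k)%N :> nat ->
    row j (castmx (e, e) (block_mx (\mxdiag_(i < m) x) 0 0 0) *m Z) =
    row k (x *m G).
Proof.
case: L / e Z G => Z G ZG k j jk; rewrite castmx_id.
have {j jk} -> : j = lshift r (@tagnat.Rank m (fun=> d) t k).
  exact/val_inj/(etrans jk)/esym/Rank_const.
have -> : G = submxcol (usubmx Z) t.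
  apply/row_matrixP => l; rewrite row_rowsub row_usubmx.
  by apply/esym/ZG; exact: Rank_const.
rewrite -row_usubmx -mul_usub_mx /block_mx col_mxKu.
rewrite -[Z in LHS]vsubmxK mul_row_col mul0mx addr0 -[usubmx Z in LHS]submxcolK.
by rewrite mul_mxdiag_mxcol -row_rowsub -[rowsub _ _]/(submxcol _ _) mxcolK.
Qed.

(** * Decomposing an exact right module into standard row modules *)

Section ApproximateRepresentation.
Variables (F : fieldType) (d L : nat) (alpha : {linear 'M[F]_d.+1 -> 'M[F]_L}).

Section ExactOnSubspace.
Variable W : 'M[F]_L.
Hypotheses (W_stable : forall x, (W *m alpha x <= W)%MS)
           (W_mul : forall x y, W *m alpha x *m alpha y = W *m alpha (x *m y))
           (W_one : W *m alpha 1%:M = W).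

Lemma submodule_mul p (v : 'M_(p, L)) x y : (v <= W)%MS ->
  v *m alpha x *m alpha y = v *m alpha (x *m y).
Proof. by case/submxP=> u ->; rewrite -!mulmxA (mulmxA W) W_mul. Qed.

Let B := row_base (W *m alpha (delta_mx 0 0)).
Let w := \rank (W *m alpha (delta_mx 0 0)).

Let G (t : 'I_w) : 'M[F]_(d.+1, L) :=
  \matrix_k (row t B *m alpha (delta_mx 0 k)).

Lemma row_base_sub t : (row t B <= W)%MS.
Proof. by rewrite (submx_trans (row_sub _ _)) // eq_row_base. Qed.

(** The argument of [alpha] is the matrix with [u] as row 0 and zeros elsewhere, so computations
    with [G t] become products of matrices under [alpha]. *)
Lemma mul_block (t : 'I_w) (u : 'rV_d.+1) :
  u *m G t = row t B *m alpha ((delta_mx 0 0 : 'cV_d.+1) *m u).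
Proof.
rewrite mulmx_sum_row {2}(row_sum_delta u) mulmx_sumr linear_sum mulmx_sumr.
apply: eq_bigr => k _; rewrite rowK -scalemxAr linearZ -scalemxAr.
by rewrite mul_delta_mx.
Qed.

(** Row 0 of E_0k x is row k of [x], so [alpha x] acts on the span of block [t] as [x] acts on row
    vectors. *)
Lemma block_alpha (t : 'I_w) x : G t *m alpha x = x *m G t.
Proof.
apply/row_matrixP => k; rewrite !row_mul mul_block rowK.
by rewrite submodule_mul ?row_base_sub // rowE mulmxA mul_delta_mx.
Qed.

(** Multiplying a linear relation by alpha(E_k0) leaves, in each block, its k-th coefficient times
    b_t alpha(E_00) = b_t; the b_t are independent. *)
Lemma mxcol_block_free : row_free (\mxcol_t G t).
Proof.
apply: inj_row_free => u uG0; rewrite -[u]submxrowK.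
have uG : \sum_t row t B *m alpha ((delta_mx 0 0 : 'cV_d.+1) *m submxrow u t) = 0.
  rewrite -[RHS]uG0 -[u in RHS]submxrowK mul_mxrow_mxcol.
  by apply: eq_bigr => t _; rewrite mul_block.
have B1 s : row s B *m alpha (delta_mx 0 0) = row s B.
  have /submxP[v ->] : (row s B <= W *m alpha (delta_mx 0 0))%MS.
    by rewrite (submx_trans (row_sub _ _)) // eq_row_base.
  by rewrite -!mulmxA (mulmxA W) W_mul mul_delta_mx.
have u0 t k : submxrow u t 0 k = 0.
  have uB : (\row_s submxrow u s 0 k) *m B = 0.
    have := congr1 (mulmx^~ (alpha (delta_mx k 0))) uG.
    rewrite mul0mx mulmx_suml => uGk; rewrite -[RHS]uGk mulmx_sum_row.
    apply: eq_bigr => s _; rewrite submodule_mul ?row_base_sub // mxE -mulmxA.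
    have -> : submxrow u s *m delta_mx k (0 : 'I_d.+1) =
        submxrow u s 0 k *: delta_mx 0 0.
      rewrite -(mul_delta_mx (0 : 'I_1)) mulmxA -colE [col k _]mx11_scalar mxE.
      by rewrite mul_scalar_mx.
    by rewrite -scalemxAr mul_delta_mx linearZ -scalemxAr B1.
  have /rowP/(_ t) : \row_s submxrow u s 0 k = 0.
    by apply: (row_free_inj (row_base_free _)); rewrite uB mul0mx.
  by rewrite !mxE.
by apply/rowP => i; rewrite mxE u0 mxE.
Qed.

(** Since 1 is the sum of the E_k0 E_0k, [W] is the sum of the W alpha(E_k0) alpha(E_0k), and
    stability puts W alpha(E_k0) = W alpha(E_k0) alpha(E_00) inside the span of [B]. *)
Lemma sub_mxcol_block : (W <= \mxcol_t G t)%MS.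
Proof.
rewrite -W_one mx1_sum_delta linear_sum mulmx_sumr summx_sub // => k _.
rewrite -(mul_delta_mx (0 : 'I_d.+1) k k) -W_mul.
have /submxP[C ->] : (W *m alpha (delta_mx k 0) <= B)%MS.
  rewrite eq_row_base -[delta_mx k 0](mul_delta_mx (0 : 'I_d.+1)) -W_mul.
  exact: submxMr.
rewrite -mulmxA mulmx_sub //; apply/row_subP => t; rewrite row_mul.
have -> : row t B *m alpha (delta_mx 0 k) =
    row (tagnat.Rank t k) (\mxcol_t G t).
  by rewrite -row_rowsub -[rowsub _ _]/(submxcol _ _) mxcolK rowK.
exact: row_sub.
Qed.

Lemma rank_mxcol_block : \rank (\mxcol_t G t) = (w * d.+1)%N.
Proof. by rewrite (eqP mxcol_block_free) sum_nat_const card_ord. Qed.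

(** The rows of [W] lie in the left kernel of the difference, so the two ranks add up to at most
    [L]. *)
Lemma exact_on_subspace (m r : nat) (e : (\sum_(i < m) d.+1 + r = L)%N) :
  (r < d.+1)%N ->
  exists2 Y : 'M[F]_L, Y \in unitmx & forall x : 'M_d.+1,
    (\rank (invmx Y *m castmx (e, e) (block_mx (\mxdiag_(i < m) x) 0 0 0) *m Y
       - alpha x)%R + \rank W <= L)%N.
Proof.
move=> rd; have [Y Yu YG] := extend_row_free mxcol_block_free; exists Y => // x.
(* All [w] blocks fit among the [m] diagonal ones: w(d+1) <= L = m(d+1) + r < (m+1)(d+1). *)
have wm : (w <= m)%N.
  rewrite -ltnS -(ltn_pmul2r (ltn0Sn d)) -rank_mxcol_block.
  apply: leq_ltn_trans (rank_leq_col _) _.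
  by rewrite -[X in (X < _)%N]e sum_nat_const card_ord mulSn addnC ltn_add2r.
apply: leq_trans (leq_add (leqnn _) (mxrankS sub_mxcol_block)) _.
rewrite addnC mulmx0_rank_max //; apply/row_matrixP => i; rewrite row0.
rewrite row_mul row_mxcol; set t := tagnat.sig1 i; set k := tagnat.sig2 i.
have tm : (t < m)%N by apply: leq_trans (ltn_ord t) wm.
have YGt (k' : 'I_d.+1) (j : 'I_L) :
    j = (Ordinal tm * d.+1 + k')%N :> nat -> row j Y = row k' (G t).
  move=> jk; rewrite (YG (tagnat.Rank t k')); last by rewrite jk Rank_const.
  by rewrite -row_rowsub -[rowsub _ _]/(submxcol _ _) mxcolK.
have jL : (t * d.+1 + k < L)%N.
  rewrite -[X in (X < _)%N](Rank_const t k).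
  apply: leq_trans (ltn_ord (tagnat.Rank t k)) _.
  by rewrite -(eqP mxcol_block_free) rank_leq_col.
(* After cancelling [Y] against [invmx Y], the first term is row k of [x *m G t], the second row k
   of [G t *m alpha x]. *)
rewrite -(YGt k (Ordinal jL)) // mulmxBr -!row_mul !mulmxA mulmxV // mul1mx.
rewrite (@row_diag_mul _ _ _ _ _ x e _ _ _ YGt k (Ordinal jL)) //.
by rewrite -block_alpha row_mul -(YGt k (Ordinal jL)) // -row_mul subrr.
Qed.

End ExactOnSubspace.

End ApproximateRepresentation.

(** * Codimension of common kernels *)

Lemma rank_capmx_ge (F : fieldType) (L a b : nat) (A B : 'M[F]_L) :
  (L <= \rank A + a)%N -> (L <= \rank B + b)%N ->
  (L <= \rank (A :&: B)%MS + (a + b))%N.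
Proof.
move=> Aa Bb; have := mxrank_sum_cap A B; have := rank_leq_col (A + B)%MS.
lia.
Qed.

Lemma rank_bigcap_kermx (F : fieldType) (L c : nat) (I : finType)
    (D : I -> 'M[F]_L) :
  (forall i, (\rank (D i) <= c)%N) ->
  (L <= \rank (\bigcap_i kermx (D i)) + #|I| * c)%N.
Proof.
move=> Dc; rewrite cardE enumT -[Finite.enum I]/(index_enum I).
elim: (index_enum I) => [|i l IH].
  by rewrite big_nil mxrank1 leq_addr.
rewrite big_cons [size _]/= mulSn; apply: rank_capmx_ge => //.
by rewrite mxrank_ker; have := Dc i; lia.
Qed.

(** * Conjugates of block diagonal repetitions *)

Lemma mul_mxdiag (F : fieldType) (p : nat) (p_ : 'I_p -> nat)
    (u v : forall i, 'M[F]_(p_ i)) :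
  \mxdiag_i u i *m \mxdiag_i v i = \mxdiag_i (u i *m v i).
Proof.
rewrite mul_mxdiag_mxblock; apply/eq_mxblock => i j.
by case: eqVneq => [<-|_]; rewrite ?conform_mx_id ?mulmx0.
Qed.

Lemma scale_mxdiag (F : fieldType) (p : nat) (p_ : 'I_p -> nat)
    (a : F) (u : forall i, 'M[F]_(p_ i)) :
  a *: \mxdiag_i u i = \mxdiag_i (a *: u i).
Proof.
rewrite -mul_scalar_mx -mxdiagZ mul_mxdiag.
by apply/eq_mxdiag => i; rewrite mul_scalar_mx.
Qed.

(** The form demanded by [delta_embedding]. A free [r] keeps the left side of [e] independent of
    [L], so that the cast can be eliminated. *)
Definition block_embedding (F : fieldType) (d m r L : nat) (y : 'M[F]_L)
    (e : (\sum_(i < m) d + r = L)%N) (x : 'M[F]_d) : 'M[F]_L :=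
  y *m castmx (e, e) (block_mx (\mxdiag_(i < m) x) 0 0 0) *m invmx y.

Section BlockEmbedding.
Variables (F : fieldType) (d m r L : nat) (e : (\sum_(i < m) d + r = L)%N).
Variable y : 'M[F]_L.
Hypothesis y_unit : y \in unitmx.

Lemma block_embedding_linear : linear (block_embedding y e).
Proof.
move=> a u v; rewrite /block_embedding scalemxAl -mulmxDl scalemxAr -mulmxDr.
congr (_ *m _ *m _); case: L / e; rewrite !castmx_id scale_block_mx !scaler0.
by rewrite add_block_mx !addr0 scale_mxdiag mxdiagD.
Qed.

Lemma block_embedding_mul u v : block_embedding y e (u *m v) =
  block_embedding y e u *m block_embedding y e v.
Proof.
rewrite /block_embedding !mulmxA mulmxKV // -[in RHS](mulmxA y).
congr (_ *m _ *m _); case: L / e; rewrite !castmx_id mulmx_block.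
by rewrite !mul0mx !mulmx0 !addr0 mul_mxdiag.
Qed.

Lemma rank_block_embedding x : \rank (block_embedding y e x) = (m * \rank x)%N.
Proof.
rewrite /block_embedding mxrankMfree ?row_free_unit ?unitmx_inv //.
rewrite eqmxMfull ?row_full_unit //; case: L / e; rewrite castmx_id.
by rewrite rank_diag_block_mx mxrank0 addn0 rank_mxdiag sum_nat_const card_ord.
Qed.

Lemma rank_block_embeddingB u v :
  \rank (block_embedding y e u - block_embedding y e v) =
  (m * \rank (u - v)%R)%N.
Proof.
have := block_embedding_linear (-1) v u.
by rewrite !scaleN1r !(addrC (- _)) => <-; exact: rank_block_embedding.
Qed.

(* The image of 1 is an idempotent of full rank. *)
Lemma block_embedding1 : L = (m * d)%N -> block_embedding y e 1%:M = 1%:M.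
Proof.
move=> Lmd; have full : block_embedding y e 1%:M \in unitmx.
  by rewrite -row_full_unit /row_full rank_block_embedding mxrank1 Lmd.
by rewrite -[LHS](mulmxK full) -block_embedding_mul mulmx1 mulmxV.
Qed.

End BlockEmbedding.

(** * Correcting an almost multiplicative map *)

Lemma approximate_representation (F : finFieldType) (d L c m r : nat)
    (alpha : {linear 'M[F]_d.+1 -> 'M[F]_L})
    (e : (\sum_(i < m) d.+1 + r = L)%N) :
  (forall x y, \rank (alpha x *m alpha y - alpha (x *m y))%R <= c)%N ->
  (\rank (alpha 1%:M - 1%:M)%R <= c)%N -> (r < d.+1)%N ->
  exists2 y : 'M[F]_L, y \in unitmx & forall x : 'M_d.+1,
    (\rank (block_embedding y e x - alpha x)%R
       <= (#|{: 'M[F]_d.+1 * 'M[F]_d.+1 * 'M[F]_d.+1}|).+1 * c)%N.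
Proof.
move=> alphaM alpha1 rd.
pose T : finType := ('M[F]_d.+1 * 'M[F]_d.+1 * 'M[F]_d.+1)%type.
pose D (p : T) := alpha p.1.1 *m (alpha p.1.2 *m alpha p.2 - alpha (p.1.2 *m p.2)).
pose W := (kermx (alpha 1%:M - 1%:M) :&: \bigcap_p kermx (D p))%MS.
(* One kernel for the unit and one per triple, each of codimension at most [c]; finiteness of [F]
   makes the factor independent of [L]. *)
have rankW : (L <= \rank W + (#|T|).+1 * c)%N.
  rewrite mulSn; apply: rank_capmx_ge; first by rewrite mxrank_ker; lia.
  by apply: rank_bigcap_kermx => p; apply: leq_trans (mxrankM_maxr _ _) _.
have W1 : W *m alpha 1%:M = W.
  have : W *m (alpha 1%:M - 1%:M) = 0 by apply/sub_kermxP; exact: capmxSl.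
  by rewrite mulmxBr mulmx1 => /eqP; rewrite subr_eq0 => /eqP.
have WD z x y : W *m alpha z *m (alpha x *m alpha y - alpha (x *m y)) = 0.
  rewrite -mulmxA; apply/sub_kermxP; apply: submx_trans (capmxSr _ _) _.
  exact: (@bigcapmx_inf _ _ (z, x, y) predT).
(* The case z = 1, as [alpha 1%:M] fixes [W]. *)
have WM x y : W *m alpha x *m alpha y = W *m alpha (x *m y).
  apply/eqP; rewrite -subr_eq0 -mulmxA -mulmxBr.
  by rewrite -[X in X *m _]W1 WD.
(* On [W], alpha(x) alpha(z) is alpha(xz), so the condition for z on [W *m alpha x] is the one for
   xz on [W]. *)
have Wstable x : (W *m alpha x <= W)%MS.
  rewrite sub_capmx; apply/andP; split.
    by apply/sub_kermxP; rewrite mulmxBr WM !mulmx1 subrr.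
  by apply/sub_bigcapmxP => p _; apply/sub_kermxP; rewrite /D mulmxA WM WD.
have [Y Yu HY] := exact_on_subspace Wstable WM W1 e rd.
exists (invmx Y) => [|x]; first by rewrite unitmx_inv.
rewrite /block_embedding invmxK -(leq_add2r (\rank W)).
by rewrite (leq_trans (HY x)) // addnC.
Qed.

(** * Linear extension of prescribed values on the matrix units *)

Definition matrix_comb (F : fieldType) (m n : nat) (V : lmodType F)
    (a : 'I_m * 'I_n -> V) (x : 'M[F]_(m, n)) : V :=
  \sum_p x p.1 p.2 *: a p.

Lemma matrix_comb_linear (F : fieldType) (m n : nat) (V : lmodType F)
  (a : 'I_m * 'I_n -> V) : linear (matrix_comb a).
Proof.
move=> c x y; rewrite /matrix_comb scaler_sumr -big_split /=.
by apply: eq_bigr => p _; rewrite !mxE scalerDl scalerA.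
Qed.

HB.instance Definition _ (F : fieldType) (m n : nat) (V : lmodType F)
    (a : 'I_m * 'I_n -> V) :=
  GRing.isLinear.Build F 'M[F]_(m, n) V *:%R (matrix_comb a)
    (matrix_comb_linear a).

Lemma linear_matrix_comb (F : fieldType) (m n : nat) (V W : lmodType F)
    (f : V -> W) (a : 'I_m * 'I_n -> V) (x : 'M[F]_(m, n)) : linear f ->
  f (matrix_comb a x) = matrix_comb (f \o a) x.
Proof.
move=> lf; pose g : {linear V -> W} :=
  HB.pack f (GRing.isLinear.Build _ _ _ _ f lf).
rewrite -[f]/(g : V -> W) linear_sum; apply: eq_bigr => p _.
by rewrite linearZ.
Qed.

Lemma matrix_comb_delta (F : fieldType) (m n : nat) (x : 'M[F]_(m, n)) :
  matrix_comb (fun p => delta_mx p.1 p.2) x = x.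
Proof. by rewrite [RHS]matrix_sum_delta pair_bigA. Qed.

Lemma dist_sum (R : realType) (F : fieldType) (A : metricAlgType R F)
    (I : finType) (u v : I -> A) :
  dist (\sum_i u i) (\sum_i v i) <= \sum_i dist (u i) (v i).
Proof.
elim/big_rec3: _ => [|i a b c _ le]; first by rewrite distxx.
by apply: le_trans (distD _ _ _ _) _; rewrite lerD2l.
Qed.

(** Scaling does not increase distances, so the bound is uniform in the coefficients. *)
Lemma dist_matrix_comb (R : realType) (F : fieldType) (A : metricAlgType R F)
    (m n : nat) (a b : 'I_m * 'I_n -> A) (x : 'M[F]_(m, n)) (e : R) :
  (forall p, dist (a p) (b p) <= e) ->
  dist (matrix_comb a x) (matrix_comb b x) <= #|{: 'I_m * 'I_n}|%:R * e.
Proof.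
move=> ab; apply: le_trans (dist_sum _ _) _.
rewrite mulr_natl -sumr_const; apply: ler_sum => p _.
exact: le_trans (distZ _ _ _) (ab p).
Qed.

(** * Approximation in the limit algebra by finite stages *)

Section LimitIn.
Variables (R : realType) (F : fieldType) (s : factor_seq).

Lemma limit_in_linear k : linear (limit_in R s k : 'M[F]_(s k) -> _).
Proof. by have [] := limit_in_embedding R F s k. Qed.

Lemma limit_inM k (x y : 'M[F]_(s k)) :
  limit_in R s k (x *m y) = limit_in R s k x * limit_in R s k y.
Proof. by have [_ fM _ _] := limit_in_embedding R F s k; exact: fM. Qed.

Lemma limit_in1 k : limit_in R s k (1%:M : 'M[F]_(s k)) = 1.
Proof. by have [_ _ f1 _] := limit_in_embedding R F s k; exact: f1. Qed.

Lemma dist_limit_in k (x y : 'M[F]_(s k)) :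
  dist (limit_in R s k x) (limit_in R s k y) = (\rank (x - y))%:R / (s k)%:R.
Proof. by have [_ _ _ fd] := limit_in_embedding R F s k; exact: fd. Qed.

Lemma limit_in_le k K (x : 'M[F]_(s k)) : (k <= K)%N ->
  exists y : 'M[F]_(s K), limit_in R s K y = limit_in R s k x.
Proof.
move=> /subnK <-; elim: (K - k)%N => [|i [y <-]]; first by exists x.
by exists (amplify (fs_dvd s (i + k)) y); exact: limit_inS.
Qed.

(** Density gives a stage for each index; their maximum serves all of them, as elements move to
    later stages with the same image. *)
Lemma limit_in_dense_eventually (I : finType) (p : I -> limit_algebra R F s)
    (e : R) : 0 < e ->
  exists N, forall K, (N <= K)%N ->
  exists a : I -> 'M[F]_(s K), forall i, dist (limit_in R s K (a i)) (p i) <= e.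
Proof.
move=> e0; have [k kP] := choice (fun i => limit_in_dense (p i) e0).
exists (\max_i k i) => K NK.
suff /choice[a aP] : forall i, exists y : 'M[F]_(s K),
    dist (limit_in R s K y) (p i) <= e by exists a.
move=> i; have [x xp] := kP i.
have [y yx] := limit_in_le x (leq_trans (leq_bigmax i) NK).
by exists y; rewrite yx ltW.
Qed.

End LimitIn.

Lemma map_dist_le (R : realType) (F : fieldType) (n : nat)
    (B : metricAlgType R F) (f g : 'M[F]_n -> B) (e : R) :
  (forall x, dist (f x) (g x) <= e) -> map_dist f g <= e.
Proof.
move=> fg; apply: ge_sup; first by exists (dist (f 0) (g 0)), 0.
by move=> _ [x _ <-].
Qed.

Theorem lemma3p1 (R : realType) (F : finFieldType) (s : factor_seq) (n : nat)
    (phi : 'M[F]_n.+1 -> limit_algebra R F s) (phi_emb : embedding R phi)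
    (eps : R) (eps_gt0 : 0 < eps) :
  exists N : nat, forall K : nat, (N <= K)%N ->
  forall m r : nat, s K = (m * n.+1 + r)%N -> (r < n.+1)%N ->
  exists psi : 'M[F]_n.+1 -> 'M[F]_(s K),
    [/\ delta_embedding (r%:R / (s K)%:R : R) psi,
        map_dist (limit_in R s K \o psi) phi < eps
      & (n.+1 %| s K)%N -> embedding R psi].
Proof.
have [phi_lin phiM phi1 _] := phi_emb.
pose C := (#|{: 'M[F]_n.+1 * 'M[F]_n.+1 * 'M[F]_n.+1}|).+1.
pose I : finType := ('I_n.+1 * 'I_n.+1)%type.
(* The final error will be 3 C delta + delta = eps - delta; the spare delta keeps the inequality
   strict after the supremum. *)
pose delta : R := eps / (3 * C%:R + 2).
have C0 : 0 <= C%:R :> R by rewrite ler0n.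
have den_gt0 : 0 < 3 * C%:R + 2 :> R by lra.
have delta_gt0 : 0 < delta by rewrite divr_gt0.
have deltaE : delta * (3 * C%:R + 2) = eps by rewrite divfK ?gt_eqF.
clearbody delta.
have I_gt0 : 0 < #|I|%:R :> R by rewrite ltr0n card_prod card_ord.
(* Precision delta / |I| on the |I| matrix units gives precision delta for the linear extension. *)
have [N aN] := limit_in_dense_eventually (fun p : I => phi (delta_mx p.1 p.2))
  (divr_gt0 delta_gt0 I_gt0).
exists N => K NK m r Kmr rn; have [a a_phi] := aN K NK.
pose alpha : {linear 'M[F]_n.+1 -> 'M[F]_(s K)} := matrix_comb a.
have alpha_phi x : dist (limit_in R s K (alpha x)) (phi x) <= delta.
  rewrite -[in phi x](matrix_comb_delta x).
  rewrite (linear_matrix_comb a x (@limit_in_linear R F s K)).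
  rewrite (linear_matrix_comb _ x phi_lin).
  by apply: le_trans (dist_matrix_comb x a_phi) _; rewrite mulrC divfK ?gt_eqF.
have sK_gt0 : 0 < (s K)%:R :> R by rewrite ltr0n.
(* Ranks are integers, so normalized rank at most 3 delta means rank at most this floor. *)
pose c := Num.truncn (3 * delta * (s K)%:R).
have c_ge0 : 0 <= 3 * delta * (s K)%:R by rewrite !mulr_ge0 // ltW.
have le_c (u v : 'M[F]_(s K)) :
    dist (limit_in R s K u) (limit_in R s K v) <= 3 * delta ->
    (\rank (u - v)%R <= c)%N.
  by rewrite dist_limit_in ler_pdivrMr // truncn_ge_nat.
(* Compared with phi(xy), the product is off by at most 2 delta and alpha(xy) by at most delta. *)
have alphaM x y : (\rank (alpha x *m alpha y - alpha (x *m y))%R <= c)%N.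
  apply: le_c; rewrite limit_inM.
  apply: le_trans (dist_triangle (phi (x *m y)) _ _) _.
  have -> : 3 * delta = (delta + delta) + delta by lra.
  apply: lerD; last by rewrite dist_sym.
  rewrite -[x *m y]/(x * y) phiM; apply: le_trans (distM _ _ _ _) _.
  exact: lerD.
have alpha1 : (\rank (alpha 1%:M - 1%:M)%R <= c)%N.
  apply: le_c; rewrite limit_in1 -phi1; apply: le_trans (alpha_phi _) _.
  by lra.
have sKr : (s K - n.+1 * m)%N = r by rewrite Kmr mulnC addKn.
have e : (\sum_(i < m) n.+1 + (s K - n.+1 * m) = s K)%N.
  by rewrite sum_nat_const card_ord sKr.
have [|y yu y_alpha] := approximate_representation e alphaM alpha1.
  by rewrite sKr.
exists (block_embedding y e); split.
- split; [exact: block_embedding_linear | exact: block_embedding_mul |].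
  exists y, m, e; split=> //.
  (* The bound is attained: mn + r is exactly [s K]. *)
  by rewrite lerBlDr -mulrDl -natrD mulnC -Kmr divff // gt_eqF.
- apply: le_lt_trans (_ : C%:R * (3 * delta) + delta < eps); last first.
    by lra.
  apply: map_dist_le => x.
  apply: le_trans (dist_triangle (limit_in R s K (alpha x)) _ _) _.
  apply: lerD => //; rewrite dist_limit_in ler_pdivrMr // -mulrA.
  apply: (@le_trans _ _ (C * c)%:R); first by rewrite ler_nat y_alpha.
  by rewrite natrM ler_wpM2l // truncn_le.
- move=> dvd; have r0 : r = 0%N.
    move: dvd; rewrite Kmr dvdn_addr ?dvdn_mull // /dvdn modn_small //.
    by move/eqP.
  have Kmn : s K = (m * n.+1)%N by rewrite Kmr r0 addn0.
  split; [exact: block_embedding_linear | exact: block_embedding_mul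
         | exact: block_embedding1 |].
  move=> u v; rewrite /dist /= /rank_dist rank_block_embeddingB //.
  have -> : (fs_pred s K).+1 = (m * n.+1)%N by [].
  (* The factor [m] cancels; it is nonzero because [s K] is positive. *)
  by rewrite !natrM -mulf_div divff ?mul1r // pnatr_eq0 -lt0n; case: (m) Kmn.
Qed.
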